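(* Let $N\ge2$. For any $\tau>0$ and $\alpha,\beta\in\{1,-1\}$, for almost all $a=(a_1,\dots,a_N)\in\mathbb R_+^N$ in the sense of Lebesgue measure, there is a constant $C$ depending only on $a$, $N$ and $\tau$ such that for all $M>0$ and all $k,l\in\widetilde{\mathbb Z}^N_a\setminus\{0\}$ with $|k|,|l|\le M$, $$\alpha\,\mathrm{sg}(k)|k|-\beta\,\mathrm{sg}(l)|l|\ne0\ \Longrightarrow\ \frac1{\big|\alpha\,\mathrm{sg}(k)|k|-\beta\,\mathrm{sg}(l)|l|\big|}\le C(1+M)^{2N+2\tau-1}.$$
   Context: $\widetilde{\mathbb Z}^N_a=\{(n_1/a_1,\dots,n_N/a_N):n_1,\dots,n_N\in\mathbb Z\}\subset\mathbb R^N$, $|\cdot|$ is the Euclidean norm, and for $k\in\mathbb R^N\setminus\{0\}$, $\mathrm{sg}(k)=1$ if the first nonzero component of $k$ is positive and $\mathrm{sg}(k)=-1$ otherwise. *)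

(* Defs.v *)
From HB Require Import structures.
From mathcomp Require Import all_boot all_order all_algebra.
From mathcomp Require Import all_classical all_reals all_analysis.

Set Implicit Arguments.
Unset Strict Implicit.
Unset Printing Implicit Defensive.

Import Order.TTheory GRing.Theory Num.Theory.
Import numFieldNormedType.Exports.

Local Open Scope classical_set_scope.
Local Open Scope ring_scope.

(* [measurableTypeR R] is the library's alias of [R] carrying the Borel sets,
   so [rvec R n] is R^n with its Borel sigma-algebra. *)
Notation rvec R n := (n.-tuple (measurableTypeR R)).

Section identification.
Variables (R : realType) (n : nat).

Definition consvec (p : measurableTypeR R * rvec R n) : rvec R n.+1 :=
  [tuple of p.1 :: p.2].

Definition unconsvec (t : rvec R n.+1) : measurableTypeR R * rvec R n :=
  (thead t, [tuple of behead t]).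

Lemma consvecK : cancel consvec unconsvec.
Proof.
by move=> [x t]; rewrite /unconsvec theadE; congr pair; exact/val_inj.
Qed.

Lemma measurable_consvec : measurable_fun [set: _] consvec.
Proof. exact: measurable_cons. Qed.

Lemma measurable_unconsvec : measurable_fun [set: _] unconsvec.
Proof.
apply/measurable_fun_pairP; split.
  exact: measurable_tnth.
exact: measurable_behead.
Qed.

Lemma consvec_box (A : 'I_n.+1 -> set (measurableTypeR R)) :
  consvec @^-1` [set t | forall i, A i (tnth t i)] =
  A ord0 `*` [set t | forall i, A (lift ord0 i) (tnth t i)].
Proof.
apply/seteqP; split=> [[x t] /= xtA|[x t] /= [xA tA] i].
  split; first exact: (xtA ord0).
  by move=> i; have := xtA (lift ord0 i); rewrite /consvec /= tnthS.
case: (unliftP ord0 i) => [j ->|->]; last exact: xA.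
by rewrite /consvec /= tnthS; exact: tA.
Qed.

Lemma measurable_box m (A : 'I_m -> set (measurableTypeR R)) :
  (forall i, measurable (A i)) ->
  measurable [set t : rvec R m | forall i, A i (tnth t i)].
Proof.
move=> mA; rewrite (_ : [set _ | _] =
    \big[setI/setT]_(i < m) ((fun t : rvec R m => tnth t i) @^-1` A i)).
  apply: bigsetI_measurable => i _.
  by rewrite -[X in measurable X]setTI; exact: measurable_tnth.
apply/seteqP; split=> [t tA|t]; first by rewrite -bigcap_seq => i _; exact: tA.
by rewrite -bigcap_seq => tA i; apply: tA => /=; rewrite mem_index_enum.
Qed.

End identification.

Section cons_measure.
Variables (R : realType) (n : nat).
Variable mu : {sigma_finite_measure set (rvec R n) -> \bar R}.

(* The product of [lebesgue_measure] and [mu], carried from R x R^n to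
   R^(n+1). *)
Definition cons_measure : set (rvec R n.+1) -> \bar R :=
  pushforward (lebesgue_measure \x mu)%E (@consvec R n).

Let m0 : cons_measure set0 = 0%E.
Proof. by rewrite /cons_measure /pushforward preimage_set0 measure0. Qed.

Let m_ge0 A : (0 <= cons_measure A)%E.
Proof. by rewrite /cons_measure /pushforward measure_ge0. Qed.

Let m_sigma_additive : semi_sigma_additive cons_measure.
Proof.
move=> /= F mF tF mUF; rewrite /cons_measure /pushforward preimage_bigcup.
have mcons A : measurable A -> measurable (@consvec R n @^-1` A).
  by move=> mA; rewrite -[X in measurable X]setTI; exact: measurable_consvec.
apply: measure_semi_sigma_additive => [k| |].
- by apply: mcons; exact: mF.
- apply/trivIsetP => /= i j _ _ ij; rewrite -preimage_setI.
  by move/trivIsetP : tF => /(_ _ _ _ _ ij) ->//; rewrite preimage_set0.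
- by rewrite -preimage_bigcup; exact: mcons.
Qed.

HB.instance Definition _ := isMeasure.Build _ _ _ cons_measure
  m0 m_ge0 m_sigma_additive.

Let m_sigma_finite : sigma_finite setT cons_measure.
Proof.
have /sigma_finiteP[F [FT ndF Foo]] := sigma_finiteT (@lebesgue_measure R).
have /sigma_finiteP[G [GT ndG Goo]] := sigma_finiteT mu.
exists (fun k => @unconsvec R n @^-1` (F k `*` G k)).
  apply/seteqP; split=> // t _.
  have [i _ Fi] : (\bigcup_i F i) (unconsvec t).1 by rewrite -FT.
  have [j _ Gj] : (\bigcup_i G i) (unconsvec t).2 by rewrite -GT.
  exists (maxn i j) => //; split.
    by move: Fi; exact/subsetPset/ndF/leq_maxl.
  by move: Gj; exact/subsetPset/ndG/leq_maxr.
move=> k; have [mF Fk] := Foo k; have [mG Gk] := Goo k; split.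
  rewrite -[X in measurable X]setTI; apply: measurable_unconsvec => //.
  exact: measurableX.
rewrite /cons_measure /pushforward -comp_preimage.
rewrite (_ : _ \o _ = id); last first.
  by apply/funext => p /=; exact: consvecK.
by rewrite preimage_id product_measure1E// lte_mul_pinfty// ge0_fin_numE.
Qed.

HB.instance Definition _ := Measure_isSigmaFinite.Build _ _ _ cons_measure
  m_sigma_finite.

End cons_measure.

(* The library has Lebesgue measure on R only; on R^n it is taken as the n-fold
   product measure, starting from the unit mass on the one-point space R^0. *)
Fixpoint lebesgue_vec (R : realType) (n : nat) :
    {sigma_finite_measure set (rvec R n) -> \bar R} :=
  match n with
  | 0 => \d_ [tuple]
  | m.+1 => cons_measure (lebesgue_vec R m)
  end.

Lemma lebesgue_vec_box (R : realType) n
    (A : 'I_n -> set (measurableTypeR R)) :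
  (forall i, measurable (A i)) ->
  lebesgue_vec R n [set t | forall i, A i (tnth t i)] =
  (\prod_(i < n) lebesgue_measure (A i))%E.
Proof.
elim: n A => [|n IHn] A mA /=.
  rewrite big_ord0 diracE mem_set//.
  by case.
rewrite /cons_measure /pushforward consvec_box product_measure1E//.
  by rewrite big_ord_recl (IHn (fun i => A (lift ord0 i))).
exact: (@measurable_box R n (fun i => A (lift ord0 i))).
Qed.

Section vectors.
Variables (R : realType) (n : nat).
Implicit Types k a : rvec R n.

Definition zerovec : rvec R n := [tuple 0 | _ < n].

Definition enorm k : R := Num.sqrt (\sum_(i < n) tnth k i ^+ 2).

(* [head 0 [seq x <- k | x != 0]] is the first nonzero component of [k]; the
   value at [k = 0] (which is -1) is irrelevant. *)
Definition sg k : R := if 0 < head 0 [seq x <- k | x != 0] then 1 else -1.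

Definition scaled_lattice a : set (rvec R n) :=
  [set k | exists z : 'I_n -> int, forall i, tnth k i = (z i)%:~R / tnth a i].

Definition positive_vec a : Prop := forall i, 0 < tnth a i.

End vectors.
Arguments zerovec {R n}.

(* Main.v *)
Require Import Defs.
From HB Require Import structures.
From mathcomp Require Import all_boot all_order all_algebra.
From mathcomp Require Import all_classical all_reals all_analysis.
From mathcomp Require Import measurable_realfun ring lra zify.

Set Implicit Arguments.
Unset Strict Implicit.
Unset Printing Implicit Defensive.

Import Order.TTheory GRing.Theory Num.Theory.
Import numFieldNormedType.Exports.

Local Open Scope classical_set_scope.
Local Open Scope ring_scope.

(** The quantity to bound below is, up to sign, [|k| + |l|] or [|k| - |l|].

    The sum is harmless: [k] has a nonzero coordinate [z / a_i] with [z] an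
    integer, so [|k|] is at least the inverse of the largest [a_i].

    For the difference, multiply by [|k| + |l| <= 2M]: with [k_i = z_i / a_i] and
    [l_i = w_i / a_i],
      [|k|^2 - |l|^2 = sum_i q_i / a_i^2], where [q_i = z_i^2 - w_i^2],
    a linear form in the numbers [1 / a_i^2] with integer coefficients of size
    [O(M^2)].  Hence everything follows from the easy half of the
    Khinchin-Groshev theorem: for almost every [a] there is [c > 0] such that
    every nonzero integer vector [q] satisfies
      [|sum_i q_i / a_i^2| >= c |q|^-(N - 1 + tau)],
    [|q|] being the largest coordinate.  Indeed [|q|^(N - 1 + tau)] is
    [O((1 + M)^(2N - 2 + 2 tau))], and the factor [|k| + |l|] contributes the
    last unit of the exponent.

    The Diophantine statement is a union bound over dyadic shells
    [2^m <= |q| < 2^(m+1)].  In a cube of side [J], along a coordinate whose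
    coefficient has size at least [2^m], the form moves at speed at least
    [2^(m+1) / J^3], so it is smaller than [e] only on a short segment; by Fubini
    the set of such [a] has measure [O(e / 2^m)]
    ([lebesgue_resonance_le]).  The shell has [O(2^(m N))] points, so with
    [e = c 2^(-m (N - 1 + tau))] the exceptional set of the shell has measure
    [O(c 2^(-m tau))].  These measures sum to [O(c)]
    ([lebesgue_shell_resonances_le]), and an [a] that is exceptional for every
    [c > 0] lies in sets of arbitrarily small measure ([ae_nonresonant]).
    Using shells rather than the boxes [|q| < 2^m] is what keeps the gain
    [2^-m] in the slab estimate, hence the exponent [N - 1 + tau] instead of
    [N + tau]. *)

(** * Sets with short slices *)

(** The factor 2 is lossy but lets the covering interval be centred at any
    point of [A], with no infimum to take. *)
Lemma lebesgue_measure_le_diam (R : realType) (A : set (measurableTypeR R))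
    (d : R) :
  measurable A -> 0 <= d ->
  (forall x y : R, A x -> A y -> `|x - y| <= d) ->
  (lebesgue_measure A <= (2 * d)%:E)%E.
Proof.
move=> mA d0 Ad; have [->|/set0P[x Ax]] := eqVneq A set0.
  by rewrite measure0 lee_fin mulr_ge0.
have sub : A `<=` `[x - d, x + d]%classic.
  by move=> y Ay; have := Ad _ _ Ax Ay; rewrite ler_distlC /= in_itv.
apply: (@le_trans _ _ (lebesgue_measure (`[x - d, x + d]%classic : set R))).
  by apply: le_measure; rewrite ?inE.
rewrite lebesgue_measure_itv/= lte_fin; case: ifP => _.
  by rewrite -EFinB lee_fin; lra.
by rewrite lee_fin mulr_ge0.
Qed.

Lemma product_measureC d1 d2 (T1 : measurableType d1) (T2 : measurableType d2)
    (R : realType) (m1 : {sigma_finite_measure set T1 -> \bar R})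
    (m2 : {sigma_finite_measure set T2 -> \bar R}) (A : set (T1 * T2)) :
  measurable A -> (m1 \x m2)%E A = (m1 \x^ m2)%E A.
Proof.
move=> mA; apply: product_measure_unique => //= B C mB mC.
exact: product_measure2E.
Qed.

Lemma lebesgue_vec_cube (R : realType) n (J : R) : 0 <= J ->
  lebesgue_vec R n [set t | forall i, `[0, J]%classic (tnth t i)] = (J ^+ n)%:E.
Proof.
move=> J0; rewrite (lebesgue_vec_box (A := fun=> `[0, J]%classic))//.
rewrite (eq_bigr (fun=> J%:E)) ?prodEFin ?prodr_const ?card_ord// => i _.
rewrite lebesgue_measure_itv/= lte_fin; case: ltP => J1.
  by rewrite -EFinB subr0.
by congr EFin; lra.
Qed.

Lemma integral_le_cst d (T : measurableType d) (R : realType)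
    (mu : {measure set T -> \bar R}) (f : T -> \bar R) (B : set T) (c : R) :
  measurable B -> 0 <= c -> measurable_fun setT f -> (forall x, 0 <= f x)%E ->
  (forall x, f x <= c%:E)%E -> (forall x, ~ B x -> f x = 0)%E ->
  (\int[mu]_x f x <= c%:E * mu B)%E.
Proof.
move=> mB c0 mf f0 fc fB.
have -> : (c%:E * mu B = \int[mu]_x (c%:E * (\1_B x)%:E))%E.
  by rewrite ge0_integralZl ?integral_indic ?setIT//; exact: measurableT_comp.
apply: ge0_le_integral => //.
- by apply: measurable_funeM; exact: measurableT_comp.
- move=> x _; rewrite indicE; have [xB|/negP xB] := boolP (x \in B).
    by rewrite mule1.
  by rewrite mule0 fB// => Bx; apply: xB; rewrite inE.
Qed.

Lemma lebesgue_vecS (R : realType) n (A : set (rvec R n.+1)) :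
  lebesgue_vec R n.+1 A =
  (lebesgue_measure \x lebesgue_vec R n)%E (@consvec R n @^-1` A).
Proof. by []. Qed.

(** Integrate the lengths of the slices in the direction [i] over the
    remaining cube.  The measure is built by adding coordinates at the front,
    so for [i] the first coordinate this is one application of Fubini with the
    order of integration reversed; otherwise the front coordinate is
    integrated out and the bound is inherited from the dimension below. *)
Lemma lebesgue_vec_le_slab (R : realType) n (i : 'I_n.+1)
    (A : set (rvec R n.+1)) (J d : R) :
  measurable A -> 0 <= J -> 0 <= d ->
  (forall a, A a -> forall l, 0 <= tnth a l <= J) ->
  (forall a b, A a -> A b -> (forall l, l != i -> tnth a l = tnth b l) ->
    `|tnth a i - tnth b i| <= d) ->
  (lebesgue_vec R n.+1 A <= (2 * d * J ^+ n)%:E)%E.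
Proof.
move=> + J0 d0.
have first m (B : set (rvec R m.+1)) (mB : measurable (@consvec R _ @^-1` B)) :
  (forall a, B a -> forall l, 0 <= tnth a l <= J) ->
  (forall a b, B a -> B b -> (forall l, l != ord0 -> tnth a l = tnth b l) ->
    `|tnth a ord0 - tnth b ord0| <= d) ->
  ((lebesgue_measure \x lebesgue_vec R m) (@consvec R _ @^-1` B) <=
    (2 * d * J ^+ m)%:E)%E.
  move=> BJ Bd; rewrite product_measureC//.
  rewrite EFinM -lebesgue_vec_cube//.
  apply: integral_le_cst => //.
  - exact: (@measurable_box R m (fun=> `[0, J]%classic)).
  - by rewrite mulr_ge0.
  - exact: measurable_fun_ysection.
  - move=> y; apply: lebesgue_measure_le_diam => //.
      exact: measurable_ysection.
    move=> x x'; rewrite /ysection/= !inE => Bx Bx'.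
    have := Bd _ _ Bx Bx'; rewrite !tnth0; apply=> l.
    by case: (unliftP ord0 l) => [j ->|->]; rewrite ?eqxx// !tnthS.
  - move=> y yJ; rewrite /= [X in lebesgue_measure X](_ : _ = set0) ?measure0//.
    apply/seteqP; split => // x; rewrite /ysection/= inE => Bx.
    apply: yJ => l /=; have := BJ _ Bx (lift ord0 l).
    by rewrite tnthS in_itv.
elim: n i A => [|n IHn] i A mA AJ Ad.
all: have mA' : measurable (@consvec R _ @^-1` A)
  by rewrite -[X in measurable X]setTI; exact: measurable_consvec.
all: rewrite lebesgue_vecS.
  have i0 : i = ord0 by apply: val_inj; case: i {Ad} => -[].
  by rewrite i0 in Ad; exact: first.
case: (unliftP ord0 i) Ad => [j ->|->] Ad; last exact: first.
rewrite exprSr mulrA EFinM.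
have -> : J%:E = lebesgue_measure (`[0, J]%classic : set R).
  rewrite lebesgue_measure_itv/= lte_fin; case: ltP => J1.
    by rewrite -EFinB subr0.
  by congr EFin; lra.
apply: integral_le_cst => //.
- by rewrite !mulr_ge0 ?exprn_ge0.
- exact: measurable_fun_xsection.
- move=> x; apply: (IHn j).
  + exact: measurable_xsection.
  + move=> a; rewrite /xsection/= inE => Aa l.
    by have := AJ _ Aa (lift ord0 l); rewrite tnthS.
  + move=> a b; rewrite /xsection/= !inE => Aa Ab ab.
    have := Ad _ _ Aa Ab; rewrite !tnthS; apply=> l.
    case: (unliftP ord0 l) => [m ->|->]; rewrite ?tnth0// !tnthS => ml.
    by apply: ab; apply: contra ml => /eqP ->.
- move=> x xJ; rewrite /= [X in lebesgue_vec _ _ X](_ : _ = set0) ?measure0//.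
  apply/seteqP; split => // y; rewrite /xsection/= inE => By.
  by apply: xJ => /=; have := AJ _ By ord0; rewrite tnth0 in_itv.
Qed.

(** * Small values of an integral form in the inverse squares *)

(** The derivative of [1 / x^2] has absolute value at least [2 / J^3] on
    [(0, J]]; algebraically, [(x + y) / (x^2 y^2) >= 2 / J^3]. *)
Lemma dist_le_invsq_gap (R : realFieldType) (x y J : R) :
  0 < x <= J -> 0 < y <= J ->
  `|x - y| <= J ^+ 3 / 2 * `|x ^- 2 - y ^- 2|.
Proof.
move=> /andP[x0 xJ] /andP[y0 yJ].
have J0 : 0 < J by lra.
have x0' := ltW x0; have y0' := ltW y0.
have -> : x ^- 2 - y ^- 2 = (y - x) * ((x + y) / (x ^+ 2 * y ^+ 2)).
  by field; rewrite !gt_eqF.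
rewrite normrM [`|y - x|]distrC mulrCA; apply: ler_peMr => //.
rewrite ger0_norm ?divr_ge0 ?mulr_ge0 ?exprn_ge0 ?addr_ge0//.
rewrite [leRHS]mulrA ler_pdivlMr ?mulr_gt0 ?exprn_gt0// mul1r.
have xy : x * y <= J * J by exact: ler_pM.
have J3 : J ^+ 3 = J * J * J by ring.
have hx : x * y * y <= J ^+ 3 by rewrite J3 ler_pM// mulr_ge0.
have hy : x * x * y <= J ^+ 3 by rewrite J3 ler_pM ?mulr_ge0// ler_pM.
have := ler_wpM2l (ltW x0) hx.
have := ler_wpM2l (ltW y0) hy.
rewrite !expr2; lra.
Qed.

Definition invsq_form (R : realType) n (q : 'I_n -> int) (a : rvec R n) : R :=
  \sum_(i < n) (q i)%:~R * tnth a i ^- 2.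

(** The cube reaches down to the origin: [1 / x^2] only moves faster there, so
    no lower cutoff on [a] is imposed. *)
Definition resonance (R : realType) n (q : 'I_n -> int) (J e : R) :
    set (rvec R n) :=
  [set a | (forall i, 0 < tnth a i <= J) /\ `|invsq_form q a| < e].

Lemma measurable_resonance (R : realType) n (q : 'I_n -> int) (J e : R) :
  measurable (resonance q J e).
Proof.
(* On the cube the inverse square is a real power, whose measurability is
   known on the whole line. *)
pose f (a : rvec R n) : R := \sum_(i < n) (q i)%:~R * tnth a i `^ (- 2).
have mf : measurable_fun setT f.
  apply: measurable_sum => i; apply: measurable_funM => //.
  apply: (measurableT_comp (measurable_powR (- 2))).
  exact: measurable_tnth.
rewrite [X in measurable X](_ : _ =
  [set t | forall i : 'I_n, `]0, J]%classic (tnth t i)] `&`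
  (setT `&` (fun a => `|f a|) @^-1` `]-oo, e[%classic)).
  apply: measurableI; first by apply: (@measurable_box R n (fun=> `]0, J]%classic)).
  have : measurable_fun setT (fun a => `|f a|) by exact: measurableT_comp.
  exact.
have ff (a : rvec R n) : (forall i, 0 < tnth a i <= J) -> f a = invsq_form q a.
  move=> aJ; apply: eq_bigr => i _; have /andP[a0 _] := aJ i.
  by rewrite powRN (powR_mulrn 2)// ltW.
apply/seteqP; split => a /=.
  move=> [aJ ae]; split=> [i|]; first by rewrite /= in_itv/= aJ.
  by split => //; rewrite in_itv/= ff.
move=> [aJ [_]]; rewrite in_itv/=.
have {}aJ i : 0 < tnth a i <= J by have := aJ i; rewrite /= in_itv.
by rewrite ff.
Qed.

(** Two points of the set on a line of direction [i] have forms differing by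
    less than [2e], and the form moves there at speed at least [2h / J^3]. *)
Lemma lebesgue_resonance_le (R : realType) n (q : 'I_n.+1 -> int) (i : 'I_n.+1)
    (J e h : R) :
  0 <= J -> 0 <= e -> 0 < h -> h <= `|(q i)%:~R| ->
  (lebesgue_vec R n.+1 (resonance q J e) <=
    (2 * J ^+ n.+3 * (e / h))%:E)%E.
Proof.
move=> J0 e0 h0 hq.
have q0 : 0 < `|(q i)%:~R| :> R by exact: lt_le_trans hq.
pose d := J ^+ 3 * (e / h).
have -> : 2 * J ^+ n.+3 * (e / h) = 2 * d * J ^+ n.
  by rewrite /d -addn3 exprD; ring.
apply: (@lebesgue_vec_le_slab _ _ i) => //.
- exact: measurable_resonance.
- by rewrite mulr_ge0 ?exprn_ge0// divr_ge0// ltW.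
- by move=> a [aJ _] l; have /andP[/ltW -> ->] := aJ l.
move=> a b [aJ ae] [bJ be] ab.
apply: (le_trans (dist_le_invsq_gap (aJ i) (bJ i))).
rewrite /d -mulrA ler_wpM2l ?exprn_ge0// ler_pdivlMr//.
have E : invsq_form q a - invsq_form q b =
    (q i)%:~R * (tnth a i ^- 2 - tnth b i ^- 2).
  rewrite /invsq_form -sumrB (bigD1 i)//= big1 ?addr0 ?mulrBr// => l li.
  by rewrite ab// subrr.
have : `|invsq_form q a - invsq_form q b| <= 2 * e.
  by rewrite (le_trans (ler_normB _ _))//; lra.
rewrite E normrM => qe.
have := ler_wpM2r (normr_ge0 (tnth a i ^- 2 - tnth b i ^- 2)) hq.
lra.
Qed.

(** * Dyadic shells of integer vectors *)

Lemma measure_bigsetU_le_card d (T : measurableType d) (R : realType)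
    (mu : {measure set T -> \bar R}) (I : finType) (P : pred I)
    (F : I -> set T) (c : R) :
  0 <= c -> (forall i, measurable (F i)) ->
  (forall i, P i -> mu (F i) <= c%:E)%E ->
  (mu (\big[setU/set0]_(i | P i) F i) <= (#|I|%:R * c)%:E)%E.
Proof.
move=> c0 mF Fc.
have mS s : measurable (\big[setU/set0]_(i <- s | P i) F i).
  by apply: bigsetU_measurable => i _; exact: mF.
have H (s : seq I) :
    (mu (\big[setU/set0]_(i <- s | P i) F i) <= ((size s)%:R * c)%:E)%E.
  elim: s => [|i s IH]; first by rewrite big_nil measure0 /= mul0r.
  rewrite big_cons /= -natr1 mulrDl mul1r EFinD; case: ifPn => [Pi|_].
    apply: le_trans (measureU2 _ _ _) _ => //.
    by rewrite addeC leeD// Fc.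
  by rewrite (le_trans IH)// -EFinD lee_fin lerDl.
by rewrite cardT enumT; exact: H.
Qed.

Lemma nneseries_geometric_le (R : realType) (c r : R) :
  0 <= c -> 0 < r < 1 ->
  (\sum_(0 <= m <oo) (c * r ^+ m)%:E <= (c / (1 - r))%:E)%E.
Proof.
move=> c0 /andP[r0 r1].
apply: lime_le.
  by apply: is_cvg_nneseries => m _ _; rewrite lee_fin mulr_ge0// exprn_ge0// ltW.
apply: nearW => m; rewrite sumEFin lee_fin.
have := @geometric_le_lim R m c r c0 r0; rewrite gtr0_norm// => /(_ r1).
by rewrite /series/=.
Qed.

Definition dyadic_shell n (m : nat) (q : 'I_n -> int) : Prop :=
  (forall i, `|q i|%N < 2 ^ m.+1)%N /\ (exists i, 2 ^ m <= `|q i|%N)%N.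

Definition shell_resonance (R : realType) n m (J e : R) : set (rvec R n) :=
  [set a | exists2 q, dyadic_shell m q & resonance q J e a].

(** Enumerates the integer vectors with coordinates in [[-2^(m+1), 2^(m+1))]
    by a finite type, so that the vectors of a shell can be counted. *)
Definition ord_shift n m (f : {ffun 'I_n -> 'I_(2 ^ m.+2)}) (i : 'I_n) : int :=
  (f i)%:Z - (2 ^ m.+1)%N%:Z.

Lemma ord_shift_onto n m (q : 'I_n -> int) :
  dyadic_shell m q -> exists f : {ffun 'I_n -> 'I_(2 ^ m.+2)}, q = ord_shift f.
Proof.
move=> [ql _].
have P i : (`|(q i + (2 ^ m.+1)%N%:Z)%R| < 2 ^ m.+2)%N.
  by have := ql i; rewrite [(2 ^ m.+2)%N]expnS; lia.
exists [ffun i => Ordinal (P i)]; apply/funext => i; rewrite /ord_shift ffunE/=.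
by have := ql i; lia.
Qed.

Lemma shell_resonanceE (R : realType) n m (J e : R) :
  shell_resonance (n := n) m J e =
  \big[setU/set0]_(f : {ffun 'I_n -> 'I_(2 ^ m.+2)} |
      `[< dyadic_shell m (ord_shift f) >]) resonance (ord_shift f) J e.
Proof.
apply/seteqP; split => [a [q qm ra]|a].
  have [f qE] := ord_shift_onto qm; rewrite qE in qm ra.
  rewrite -bigcup_seq_cond; exists f => //=.
  by rewrite mem_index_enum; apply/asboolP.
rewrite -bigcup_seq_cond => -[f /= /andP[_ /asboolP fm] ra].
by exists (ord_shift f).
Qed.

Lemma measurable_shell_resonance (R : realType) n m (J e : R) :
  measurable (shell_resonance m J e : set (rvec R n)).
Proof.
rewrite shell_resonanceE; apply: bigsetU_measurable => f _.
exact: measurable_resonance.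
Qed.

Lemma lebesgue_shell_resonance_le (R : realType) n m (J e : R) :
  0 <= J -> 0 <= e ->
  (lebesgue_vec R n.+1 (shell_resonance m J e) <=
    ((2 ^+ m.+2) ^+ n.+1 * (2 * J ^+ n.+3 * (e / 2 ^+ m)))%:E)%E.
Proof.
move=> J0 e0; rewrite shell_resonanceE.
have -> : (2 ^+ m.+2) ^+ n.+1 = #|{: {ffun 'I_n.+1 -> 'I_(2 ^ m.+2)}}|%:R :> R.
  by rewrite card_ffun !card_ord !natrX.
apply: measure_bigsetU_le_card.
- by apply: mulr_ge0; [rewrite mulr_ge0 ?exprn_ge0|rewrite divr_ge0 ?exprn_ge0].
- by move=> f; exact: measurable_resonance.
move=> f /asboolP[_ [i fi]]; apply: (@lebesgue_resonance_le _ _ _ i _ _ (2 ^+ m)) => //.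
by rewrite -intr_norm -natrX ler_nat.
Qed.

(** * The Diophantine condition holds almost everywhere *)

(** For [q] in the [m]-th shell, the [m]-th power of [2^-(n + tau)] is
    comparable to [|q|^-(n + tau)], with [n + 1] variables. *)
Definition nonresonant (R : realType) n (tau : R) (a : rvec R n.+1) : Prop :=
  exists2 c : R, 0 < c & forall m (q : 'I_n.+1 -> int), dyadic_shell m q ->
    c * (2 `^ (- (n%:R + tau))) ^+ m <= `|invsq_form q a|.

(** The [m]-th shell contributes [2^(m (n + 1))] vectors, each with measure
    of order [e 2^(-m (n + tau)) / 2^m]; what is left is a geometric series of
    ratio [2^-tau]. *)
Lemma lebesgue_shell_resonances_le (R : realType) n (tau J e : R) :
  0 < tau -> 0 <= J -> 0 <= e ->
  (lebesgue_vec R n.+1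
     (\bigcup_m shell_resonance m J (e * (2 `^ (- (n%:R + tau))) ^+ m)) <=
    (e * (4 ^+ n.+1 * (2 * J ^+ n.+3) / (1 - 2 `^ (- tau))))%:E)%E.
Proof.
move=> tau0 J0 e0; set theta := 2 `^ (- (n%:R + tau)).
have theta0 : 0 <= theta by exact: powR_ge0.
pose rho : R := 2 `^ (- tau).
have rho01 : 0 < rho < 1.
  rewrite /rho powR_gt0//= powRN invf_lt1 ?powR_gt0//.
  apply: (@le_lt_trans _ _ (1 `^ tau)); first by rewrite powR1.
  by rewrite gt0_ltr_powR ?nnegrE// ltr1n.
have rhoE : rho = 2 ^+ n * theta.
  rewrite /theta opprD powRD; last by rewrite pnatr_eq0 implybT.
  by rewrite mulrA powRN powR_mulrn// divff ?mul1r// expf_neq0// pnatr_eq0.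
pose c := e * (4 ^+ n.+1 * (2 * J ^+ n.+3)).
have c0 : 0 <= c by rewrite mulr_ge0// mulr_ge0 ?exprn_ge0// mulr_ge0 ?exprn_ge0.
rewrite [X in X%:E](_ : _ = c / (1 - rho)); last by rewrite /c !mulrA.
apply: le_trans (nneseries_geometric_le c0 rho01).
have mE m : measurable (shell_resonance m J (e * theta ^+ m) : set (rvec R n.+1)).
  exact: measurable_shell_resonance.
apply: (@le_trans _ _ (\sum_(0 <= m <oo)
    lebesgue_vec R n.+1 (shell_resonance m J (e * theta ^+ m)))%E).
  by apply: measure_sigma_subadditive => //; exact: bigcupT_measurable.
apply: lee_nneseries => // m _.
apply: le_trans (lebesgue_shell_resonance_le _ _ _ _) _ => //.
  by rewrite mulr_ge0// exprn_ge0.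
rewrite lee_fin le_eqVlt; apply/orP; left; apply/eqP.
have -> : (2 : R) ^+ m.+2 = 2 ^+ m * 4.
  by rewrite -[m.+2]addn2 exprD; congr (_ * _); ring.
have t0 : (2 : R) ^+ m != 0 by rewrite expf_neq0// pnatr_eq0.
rewrite rhoE !exprMn [(2 ^+ m) ^+ n.+1]exprS [(2 ^+ m) ^+ n]exprAC /c.
by field.
Qed.

(** Positive vectors are exhausted by countably many cubes.  In the cube of
    side [J], the vectors failing the condition fail it for each constant
    [1 / (j + 1)], so they lie in sets of measure at most [K / (j + 1)]. *)
Lemma ae_nonresonant (R : realType) n (tau : R) : 0 < tau ->
  {ae lebesgue_vec R n.+1, forall a, positive_vec a -> nonresonant tau a}.
Proof.
move=> tau0; set theta := 2 `^ (- (n%:R + tau)).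
pose E J e : set (rvec R n.+1) :=
  \bigcup_m shell_resonance m J (e * theta ^+ m).
pose B (J : nat) : set (rvec R n.+1) := \bigcap_j E J%:R j.+1%:R^-1.
have mE J e : measurable (E J e).
  by apply: bigcupT_measurable => m; exact: measurable_shell_resonance.
have mB J : measurable (B J) by apply: bigcapT_measurable => j; exact: mE.
apply: (@negligibleS _ _ _ _ (\bigcup_J B J)); last first.
  apply: negligible_bigcup => J; apply/negligibleP => //.
  pose K : R := 4 ^+ n.+1 * (2 * J%:R ^+ n.+3) / (1 - 2 `^ (- tau)).
  have BK j : (lebesgue_vec R n.+1 (B J) <= (j.+1%:R^-1 * K)%:E)%E.
    have j0 : 0 <= j.+1%:R^-1 :> R by rewrite invr_ge0.
    apply: le_trans (lebesgue_shell_resonances_le n tau0 (ler0n R J) j0).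
    apply: le_measure; rewrite ?inE//; first exact: mE.
    by move=> a; apply.
  apply/eqP; rewrite -measure_le0; apply/lee_addgt0Pr => e e0.
  rewrite add0e.
  have [K0|K0] := leP K 0.
    apply: le_trans (BK 0%N) _; rewrite lee_fin invr1 mul1r; lra.
  have /archi_boundP := divr_ge0 (ltW K0) (ltW e0).
  set j := Num.bound _ => Kj.
  apply: le_trans (BK j) _; rewrite lee_fin mulrC ler_pdivrMr//.
  rewrite -ler_pdivrMl// mulrC (le_trans (ltW Kj))// ler_nat //.
move=> a /= /not_implyP[a0 aN].
pose J := Num.bound (\sum_i tnth a i).
exists J => // j _; apply: contra_notP aN => aE.
exists j.+1%:R^-1; first by rewrite invr_gt0.
move=> m q qm; rewrite leNgt; apply/negP => qa.
apply: aE; exists m => //; exists q => //; split => // i; rewrite a0/=.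
apply: ltW; apply: (@le_lt_trans _ _ (\sum_i tnth a i)).
  by rewrite (bigD1 i)//= lerDl sumr_ge0// => l _; rewrite ltW.
by apply: archi_boundP; rewrite sumr_ge0// => l _; rewrite ltW.
Qed.

(** From shells back to the size of [q]: the shell of [q] is given by the
    binary logarithm of its largest coordinate. *)
Lemma nonresonant_lower_bound (R : realType) n (tau : R) (a : rvec R n.+1) :
  0 < tau -> nonresonant tau a ->
  exists2 c : R, 0 < c & forall (q : 'I_n.+1 -> int) (Q : R),
    (exists i, q i != 0) -> (forall i, `|(q i)%:~R| <= Q) ->
    c <= `|invsq_form q a| * Q `^ (n%:R + tau).
Proof.
move=> tau0 [c c0 H]; exists c => // q Q [i0 qi0] qQ.
set s := n%:R + tau.
have s0 : 0 <= s by rewrite addr_ge0// ltW.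
pose h := (\max_i `|q i|)%N.
have qh i : (`|q i| <= h)%N by exact: (leq_bigmax i).
have [i hi] : {i | h = `|q i|%N}.
  by apply: (@bigop.eq_bigmax _ (fun i => `|q i|%N)); rewrite card_ord.
have h0 : (0 < h)%N by rewrite (leq_trans _ (qh i0))// absz_gt0.
pose m := trunc_log 2 h.
have mh : (2 ^ m <= h)%N by exact: trunc_logP.
have qm : dyadic_shell m q.
  split=> [j|]; last by exists i; rewrite -hi.
  by rewrite (leq_ltn_trans (qh j))// trunc_log_ltn.
apply: le_trans (_ : `|invsq_form q a| * (2 ^+ m) `^ s <= _).
  have t0 : 0 < (2 ^+ m : R) `^ s by rewrite powR_gt0// exprn_gt0.
  rewrite -ler_pdivrMr//; apply: le_trans (H m q qm).
  rewrite ler_pM2l// powRN exprVn lef_pV2 ?posrE ?exprn_gt0 ?powR_gt0//.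
  by rewrite -!powR_mulrn ?powR_ge0// powRAC.
rewrite ler_wpM2l// ge0_ler_powR// ?nnegrE ?exprn_ge0//.
  exact: le_trans (qQ i).
by apply: le_trans (qQ i); rewrite -intr_norm -natrX ler_nat -hi.
Qed.

(** * Norms of lattice vectors *)

Section geometry.
Variables (R : realType) (n : nat).
Implicit Types a k l : rvec R n.

Lemma enorm_ge0 k : 0 <= enorm k.
Proof. exact: sqrtr_ge0. Qed.

Lemma sqr_enorm k : enorm k ^+ 2 = \sum_(i < n) tnth k i ^+ 2.
Proof. by rewrite sqr_sqrtr// sumr_ge0// => i _; rewrite sqr_ge0. Qed.

Lemma norm_tnth_le_enorm k i : `|tnth k i| <= enorm k.
Proof.
rewrite -(@ler_pXn2r _ 2)// ?nnegrE ?enorm_ge0// sqr_enorm real_normK ?num_real//.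
by rewrite (bigD1 i)//= lerDl sumr_ge0// => j _; rewrite sqr_ge0.
Qed.

Lemma sg_sign k : sg k = 1 \/ sg k = -1.
Proof. by rewrite /sg; case: ifP; [left|right]. Qed.

Lemma scaled_lattice_enorm_ge a k A :
  positive_vec a -> (forall i, tnth a i <= A) ->
  scaled_lattice a k -> k <> zerovec -> A^-1 <= enorm k.
Proof.
move=> a0 aA [z kz] k0.
have [i ki] : exists i, tnth k i != 0.
  apply: contra_notP k0 => /forallNP k0; apply: eq_from_tnth => i.
  by rewrite tnth_mktuple; apply/eqP/negPn/negP; exact: k0.
apply: le_trans (norm_tnth_le_enorm k i).
have z1 : 1 <= `|(z i)%:~R| :> R.
  rewrite -intr_norm (ler1n _ `|z i|) absz_gt0; apply: contra ki => /eqP zi0.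
  by rewrite kz zi0 mul0r.
rewrite kz normrM normfV (gtr0_norm (a0 i)) ler_pdivlMr//.
apply: le_trans z1; rewrite mulrC ler_pdivrMr ?mul1r//.
exact: lt_le_trans (a0 i) (aA i).
Qed.

Lemma sqr_enorm_sub a k l (z w : 'I_n -> int) :
  (forall i, tnth k i = (z i)%:~R / tnth a i) ->
  (forall i, tnth l i = (w i)%:~R / tnth a i) ->
  enorm k ^+ 2 - enorm l ^+ 2 = invsq_form (fun i => z i ^+ 2 - w i ^+ 2) a.
Proof.
move=> kz lw; rewrite !sqr_enorm -sumrB; apply: eq_bigr => i _.
by rewrite kz lw !expr_div_n -mulrBl rmorphB /= !rmorphXn.
Qed.

(** The integer [z i] is [a_i k_i], of size at most [A M]; two squares in
    [[0, (A M)^2]] differ by at most [(A M)^2]. *)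
Lemma sqr_coord_sub_le a k l A M (z w : 'I_n -> int) i :
  positive_vec a -> (forall i, tnth a i <= A) ->
  (forall i, tnth k i = (z i)%:~R / tnth a i) ->
  (forall i, tnth l i = (w i)%:~R / tnth a i) ->
  enorm k <= M -> enorm l <= M ->
  `|(z i ^+ 2 - w i ^+ 2)%:~R| <= (A * M) ^+ 2.
Proof.
move=> a0 aA kz lw kM lM.
have H (v : rvec R n) (y : 'I_n -> int) :
    (forall i, tnth v i = (y i)%:~R / tnth a i) -> enorm v <= M ->
    0 <= ((y i)%:~R : R) ^+ 2 <= (A * M) ^+ 2.
  move=> vy vM; rewrite sqr_ge0/= -real_normK ?num_real//.
  have -> : (y i)%:~R = tnth a i * tnth v i.
    by rewrite vy mulrC divfK// gt_eqF.
  rewrite lerXn2r ?nnegrE//.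
    rewrite mulr_ge0//; first exact: le_trans (ltW (a0 i)) (aA i).
    exact: le_trans (enorm_ge0 v) vM.
  rewrite normrM (gtr0_norm (a0 i)) ler_pM ?(ltW (a0 i))//.
  exact: le_trans (norm_tnth_le_enorm v i) vM.
have /andP[z0 zM] := H k z kz kM; have /andP[w0 wM] := H l w lw lM.
by rewrite rmorphB !rmorphXn/= ler_norml; lra.
Qed.

End geometry.

(** * Gaps between signed norms *)

Lemma norm_signed_sub (R : realType) (e1 e2 x y : R) :
  e1 = 1 \/ e1 = -1 -> e2 = 1 \/ e2 = -1 -> 0 <= x -> 0 <= y ->
  `|e1 * x - e2 * y| = `|x - y| \/ `|e1 * x - e2 * y| = x + y.
Proof.
move=> [->|->] [->|->] x0 y0.
- by left; rewrite !mul1r.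
- by right; rewrite mul1r mulN1r opprK ger0_norm// addr_ge0.
- by right; rewrite mul1r mulN1r -opprD normrN ger0_norm// addr_ge0.
- by left; rewrite !mulN1r -opprD normrN.
Qed.

(** All signs are quantified inside, so that one constant chosen from [a] and
    [tau] alone serves every pair [alpha, beta]. *)
Definition signed_gap_bound (R : realType) N (tau : R) (a : rvec R N) (C : R) :
    Prop :=
  forall alpha beta : R,
    (alpha = 1 \/ alpha = -1) -> (beta = 1 \/ beta = -1) ->
    forall M : R, 0 < M ->
    forall k l : rvec R N,
      scaled_lattice a k -> k <> zerovec ->
      scaled_lattice a l -> l <> zerovec ->
      enorm k <= M -> enorm l <= M ->
      alpha * sg k * enorm k - beta * sg l * enorm l <> 0 ->
      1 / `|alpha * sg k * enorm k - beta * sg l * enorm l|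
        <= C * (1 + M) `^ (2 * N%:R + 2 * tau - 1).

Lemma sign_mul (R : realType) (x y : R) :
  x = 1 \/ x = -1 -> y = 1 \/ y = -1 -> x * y = 1 \/ x * y = -1.
Proof.
by move=> [->|->] [->|->]; rewrite ?mul1r ?mulN1r ?opprK; tauto.
Qed.

Lemma enorm_gap_bound (R : realType) n (tau A c M : R) (a k l : rvec R n.+1) :
  0 < tau -> 0 < c -> 0 < A -> 0 < M ->
  positive_vec a -> (forall i, tnth a i <= A) ->
  (forall (q : 'I_n.+1 -> int) (Q : R),
    (exists i, q i != 0) -> (forall i, `|(q i)%:~R| <= Q) ->
    c <= `|invsq_form q a| * Q `^ (n%:R + tau)) ->
  scaled_lattice a k -> scaled_lattice a l -> enorm k <= M -> enorm l <= M ->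
  enorm k - enorm l != 0 ->
  1 / `|enorm k - enorm l| <=
    2 * A `^ (2 * (n%:R + tau)) / c * (1 + M) `^ (2 * (n%:R + tau) + 1).
Proof.
move=> tau0 c0 A0 M0 a0 aA dio [z kz] [w lw] kM lM kl0.
set s := n%:R + tau.
pose q i := z i ^+ 2 - w i ^+ 2.
have fq := sqr_enorm_sub kz lw.
(* If [q] vanished, [k] and [l] would have the same norm. *)
have q0 : exists i, q i != 0.
  apply: contrapT => /forallNP q0; move/eqP: kl0; apply.
  have : enorm k ^+ 2 - enorm l ^+ 2 = 0.
    rewrite fq; apply: big1 => i _; have /negP/negPn/eqP := q0 i.
    by rewrite /q => ->; rewrite mul0r.
  move/eqP; rewrite subr_eq0 eqrXn2 ?enorm_ge0// => /eqP ->.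
  by rewrite subrr.
have qQ i : `|(q i)%:~R| <= (A * (1 + M)) ^+ 2.
  apply: le_trans (sqr_coord_sub_le i a0 aA kz lw kM lM) _.
  have AM : A * M <= A * (1 + M) by rewrite ler_pM2l//; lra.
  by rewrite lerXn2r ?nnegrE// ?mulr_ge0//; lra.
have M1 : 0 <= 1 + M by lra.
have {dio} := dio q _ q0 qQ; rewrite -fq.
rewrite -[(_ * _) ^+ 2]powR_mulrn ?mulr_ge0 ?(ltW A0)// -powRrM.
rewrite powRM ?(ltW A0)// -/s => dio.
rewrite powRD; last by apply/implyP => _; rewrite gt_eqF//; lra.
rewrite powRr1// ler_pdivrMr ?normr_gt0//.
set X := A `^ _ in dio *; set Y := (1 + M) `^ _ in dio *.
have X0 : 0 <= X by exact: powR_ge0.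
have Y0 : 0 <= Y by exact: powR_ge0.
have kl : 0 <= enorm k + enorm l <= 2 * (1 + M).
  by rewrite addr_ge0 ?enorm_ge0//=; lra.
rewrite subr_sqr normrM (ger0_norm (proj1 (andP kl))) in dio.
have -> : 2 * X / c * (Y * (1 + M)) * `|enorm k - enorm l| =
    `|enorm k - enorm l| * (2 * (1 + M)) * (X * Y) / c by ring.
rewrite ler_pdivlMr// mul1r; apply: le_trans dio _.
rewrite ler_wpM2r ?mulr_ge0// ler_wpM2l//.
by case/andP: kl.
Qed.

Lemma ex_signed_gap_bound (R : realType) n (tau : R) (a : rvec R n.+1) :
  0 < tau -> positive_vec a -> nonresonant tau a ->
  exists C, signed_gap_bound tau a C.
Proof.
move=> tau0 a0 /(nonresonant_lower_bound tau0)[c c0 dio].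
pose A := \sum_i tnth a i.
have aA i : tnth a i <= A.
  by rewrite /A (bigD1 i)//= lerDl sumr_ge0// => l _; rewrite ltW.
have A0 : 0 < A by exact: lt_le_trans (a0 ord0) (aA ord0).
pose C1 := 2 * A `^ (2 * (n%:R + tau)) / c.
have C10 : 0 <= C1 by rewrite divr_ge0 ?mulr_ge0 ?powR_ge0// ltW.
exists (C1 + A) => alpha beta al be M M0 k l ak k0 al' l0 kM lM.
have eE : 2 * n.+1%:R + 2 * tau - 1 = 2 * (n%:R + tau) + 1 :> R.
  by rewrite -natr1; ring.
rewrite eE; set e := _ + 1 : R.
have P1 : 1 <= (1 + M) `^ e.
  rewrite -[leLHS](powRr0 (1 + M)) ler_powR//; first by lra.
  by rewrite addr_ge0// mulr_ge0// addr_ge0// ltW.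
have P0 := le_trans ler01 P1.
move=> /eqP; rewrite -normr_eq0.
have [->|->] := norm_signed_sub (sign_mul al (sg_sign k))
    (sign_mul be (sg_sign l)) (enorm_ge0 k) (enorm_ge0 l).
  rewrite normr_eq0 => kl0.
  apply: le_trans (enorm_gap_bound tau0 c0 A0 M0 a0 aA dio ak al' kM lM kl0) _.
  by rewrite ler_wpM2r// lerDl ltW.
move=> _; apply: (@le_trans _ _ A); last first.
  by rewrite -[leLHS]mulr1 ler_pM// ?(ltW A0)// lerDr.
have kA := scaled_lattice_enorm_ge a0 aA ak k0.
have klA : A^-1 <= enorm k + enorm l by have := enorm_ge0 l; lra.
have A'0 : 0 < A^-1 by rewrite invr_gt0.
by rewrite div1r -[leRHS]invrK lef_pV2 ?posrE//; lra.
Qed.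

Theorem proposition5p1 (R : realType) (N : nat) (hN : (2 <= N)%N) :
  exists C : rvec R N -> R -> R,
  forall tau : R, 0 < tau ->
  forall alpha beta : R,
    (alpha = 1 \/ alpha = -1) -> (beta = 1 \/ beta = -1) ->
  {ae lebesgue_vec R N, forall a : rvec R N, positive_vec a ->
    forall M : R, 0 < M ->
    forall k l : rvec R N,
      scaled_lattice a k -> k <> zerovec ->
      scaled_lattice a l -> l <> zerovec ->
      enorm k <= M -> enorm l <= M ->
      alpha * sg k * enorm k - beta * sg l * enorm l <> 0 ->
      1 / `|alpha * sg k * enorm k - beta * sg l * enorm l|
        <= C a tau * (1 + M) `^ (2 * N%:R + 2 * tau - 1)}.
Proof.
case: N hN => [//|n] _.
(* Any admissible constant may be chosen; 0 is the default value where there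
   is none. *)
exists (fun a tau => xget 0 [set C | signed_gap_bound tau a C]).
move=> tau tau0 alpha beta al be.
apply: filterS (ae_nonresonant n tau0) => a nra a0 M M0.
have [C aC] := ex_signed_gap_bound tau0 a0 (nra a0).
exact: (xgetPex 0 (ex_intro _ C aC) alpha beta al be M M0).
Qed.
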